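(* For every target rate $r>0$, $P_{\rm r}>0$ and $\mathcal C_x\in[0,1)$, writing $\beta=\frac{\Psi_r(\mathcal C_x)}{P_{\rm r}\theta_{\rm rd}(1-\mathcal C_x^2)}$, \[ \mathcal P_{\rm E-E}=1-\frac{e^{-\beta}}{\Gamma(m_{\rm sd})\Gamma(m_{\rm rr})\Gamma(m_{\rm sr})\theta_{\rm sd}^{m_{\rm sd}}\theta_{\rm rr}^{m_{\rm rr}}}\sum_{m=0}^{m_{\rm rd}-1}\sum_{k=0}^m\binom mk\frac{P_{\rm s}^k\Gamma(k+m_{\rm sd})\beta^m}{\Gamma(m+1)\left(P_{\rm s}\beta+\frac1{\theta_{\rm sd}}\right)^{k+m_{\rm sd}}}\int_0^\infty x^{m_{\rm rr}-1}\Gamma\!\left(m_{\rm sr},\frac{P_{\rm r}x+1}{P_{\rm s}\theta_{\rm sr}}\Psi_r\!\left(\frac{P_{\rm r}x\,\mathcal C_x}{P_{\rm r}x+1}\right)\right)e^{-x/\theta_{\rm rr}}dx . \]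
   Context: Let $P_{\rm s}>0$, $P_{\rm r}>0$ be the source and relay transmit powers. For links $ij\in\{\mathrm{sr},\mathrm{rr},\mathrm{rd},\mathrm{sd}\}$ let $g_{ij}$ be mutually independent random channel gains, $g_{ij}$ gamma distributed with integer shape parameter $m_{ij}\ge1$ and scale $\theta_{ij}=\pi_{ij}/m_{ij}$, where $\pi_{ij}=\mathbb E[g_{ij}]>0$; i.e. $g_{ij}$ has density $x^{m_{ij}-1}e^{-x/\theta_{ij}}/(\Gamma(m_{ij})\theta_{ij}^{m_{ij}})$ for $x\ge0$. For a circularity coefficient $\mathcal C_x\in[0,1)$ define $R_{\rm sr}(P_{\rm r},\mathcal C_x)=\tfrac12\log_2\frac{(P_{\rm s}g_{\rm sr}+P_{\rm r}g_{\rm rr}+1)^2-(P_{\rm r}g_{\rm rr}\mathcal C_x)^2}{(P_{\rm r}g_{\rm rr}+1)^2-(P_{\rm r}g_{\rm rr}\mathcal C_x)^2}$ and $R_{\rm rd}(P_{\rm r},\mathcal C_x)=\tfrac12\log_2\frac{(P_{\rm r}g_{\rm rd}+P_{\rm s}g_{\rm sd}+1)^2-(P_{\rm r}g_{\rm rd}\mathcal C_x)^2}{(P_{\rm s}g_{\rm sd}+1)^2}$. For a target rate $r>0$ put $\gamma=2^{2r}-1$, $\eta=2^r-1$ and $\Psi_r(x)=\sqrt{1+\gamma(1-x^2)}-1$. The outage probabilities are $\mathcal P_{\rm sr}=\mathbb P\{R_{\rm sr}<r\}$, $\mathcal P_{\rm rd}=\mathbb P\{R_{\rm rd}<r\}$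 and $\mathcal P_{\rm E-E}=\mathbb P\{\min(R_{\rm sr},R_{\rm rd})<r\}$. $\Gamma(a,x)=\int_x^\infty t^{a-1}e^{-t}dt$ is the upper incomplete gamma function. *)

(* Defs.v *)
From HB Require Import structures.
From mathcomp Require Import all_boot all_order all_algebra.
From mathcomp Require Import all_classical all_reals all_analysis.
Set Implicit Arguments. Unset Strict Implicit. Unset Printing Implicit Defensive.
Import Order.TTheory GRing.Theory Num.Theory.
Import numFieldNormedType.Exports.
Local Open Scope classical_set_scope.
Local Open Scope ring_scope.

(* Upper incomplete gamma function Gamma(a,x) = int_x^oo t^(a-1) e^(-t) dt,
   for integer shape a >= 1 (only integer arguments are used). *)
Definition upper_gamma {R : realType} (a : nat) (x : R) : R :=
  Rintegral lebesgue_measure `[x, +oo[%classic (fun t : R => t ^+ a.-1 * expR (- t)).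

Definition Gamma {R : realType} (a : nat) : R := upper_gamma a 0.

Definition gamma_pdf {R : realType} (m : nat) (theta : R) (x : R) : R :=
  if 0 <= x then x ^+ m.-1 * expR (- (x / theta)) / (Gamma m * theta ^+ m) else 0.

Definition log2 {R : realType} (x : R) : R := ln x / ln 2.

Definition R_sr {R : realType} (Ps Pr Cx gsr grr : R) : R :=
  2^-1 * log2 (((Ps * gsr + Pr * grr + 1) ^+ 2 - (Pr * grr * Cx) ^+ 2) /
               ((Pr * grr + 1) ^+ 2 - (Pr * grr * Cx) ^+ 2)).

Definition R_rd {R : realType} (Ps Pr Cx grd gsd : R) : R :=
  2^-1 * log2 (((Pr * grd + Ps * gsd + 1) ^+ 2 - (Pr * grd * Cx) ^+ 2) /
               ((Ps * gsd + 1) ^+ 2)).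

Definition gam {R : realType} (r : R) : R := powR 2 (2 * r) - 1.
Definition Psi {R : realType} (r x : R) : R := Num.sqrt (1 + gam r * (1 - x ^+ 2)) - 1.

Definition has_gamma_law {d} {T : measurableType d} {R : realType}
  (P : probability T R) (X : T -> R) (m : nat) (theta : R) : Prop :=
  forall A : set R, measurable A ->
    P (X @^-1` A) = (\int[lebesgue_measure]_(x in A) (gamma_pdf m theta x)%:E)%E.

Definition indep4 {d} {T : measurableType d} {R : realType}
  (P : probability T R) (X1 X2 X3 X4 : T -> R) : Prop :=
  forall A1 A2 A3 A4 : set R,
    measurable A1 -> measurable A2 -> measurable A3 -> measurable A4 ->
    P (X1 @^-1` A1 `&` X2 @^-1` A2 `&` X3 @^-1` A3 `&` X4 @^-1` A4) =
    (P (X1 @^-1` A1) * P (X2 @^-1` A2) * P (X3 @^-1` A3) * P (X4 @^-1` A4))%E.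

(* Main.v *)
Require Import Defs.
From HB Require Import structures.
From mathcomp Require Import all_boot all_order all_algebra.
From mathcomp Require Import all_classical all_reals all_analysis.
From mathcomp Require Import measurable_realfun ring lra.
Import Order.TTheory GRing.Theory Num.Theory.
Import numFieldNormedType.Exports.
Local Open Scope classical_set_scope.
Local Open Scope ring_scope.

(** For nonnegative gains, completing the square turns [R_sr >= r] into
    [F g_rr <= g_sr] and [R_rd >= r] into [H g_sd <= g_rd], with explicit [F] and
    an affine [H]. These two events involve disjoint pairs of gains, so the
    probability that both hold is a product, and conditioning on [g_rr], resp.
    [g_sd], gives one integral for each factor. For an integer shape the tail of a
    gamma law is a Poisson distribution function: in the first factor it is
    rewritten as [upper_gamma], in the second one it is expanded by the binomial
    formula and integrated term by term. *)

(** * The Poisson distribution function and the incomplete gamma integral *)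

(** For [0 <= x], the probability that a Poisson variable of mean [x] is strictly less than [n].
    With the strict bound, the index is the shape of the gamma law whose tail is being described. *)
Definition poisson_cdf {R : realType} (n : nat) (x : R) : R :=
  expR (- x) * \sum_(k < n) x ^+ k / k`!%:R.

(** The exponential is at least its Taylor term of degree [n.+1], one more than the power present,
    so the product is squeezed between 0 and a multiple of [x^-1]. *)
Lemma cvgr_exprn_expRN {R : realType} (n : nat) :
  x ^+ n * expR (- x) @[x --> +oo%R] --> (0 : R).
Proof.
apply: (@squeeze_cvgr _ _ _ _ (fun=> 0) (fun x : R => n.+1`!%:R * x^-1)).
- near=> x.
  have x0 : 0 < x by near: x; exact: nbhs_pinfty_gt.
  rewrite mulr_ge0 ?expR_ge0 ?exprn_ge0 ?(ltW x0)//=.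
  rewrite expRN ler_pdivrMr ?expR_gt0// mulrAC ler_pdivlMr// -exprSr.
  rewrite mulrC -ler_pdivrMr ?ltr0n ?fact_gt0//.
  by apply: le_trans (expR_ge1Dxn n (ltW x0)); rewrite lerDr.
- exact: cvg_cst.
- rewrite -[X in _ --> X](mulr0 n.+1`!%:R).
  by apply: cvgMr; apply/gtr0_cvgV0 => //; exact: nbhs_pinfty_gt.
Unshelve. all: by end_near. Qed.

Lemma cvgr_poisson_cdf {R : realType} (n : nat) (c : R) : 0 < c ->
  poisson_cdf n (c * x) @[x --> +oo%R] --> (0 : R).
Proof.
move=> c0.
suff h : poisson_cdf n x @[x --> +oo%R] --> (0 : R).
  exact: (cvg_comp _ _ (gt0_cvgMry c0 cvg_id) h).
elim: n => [|n ih].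
  rewrite /poisson_cdf; under eq_fun do rewrite big_ord0 mulr0.
  exact: cvg_cst.
rewrite (_ : poisson_cdf n.+1 = fun x : R =>
  poisson_cdf n x + n`!%:R^-1 * (x ^+ n * expR (- x))); last first.
  by apply/funext => x; rewrite /poisson_cdf big_ord_recr/= mulrDr; congr (_ + _); ring.
rewrite -[X in _ --> X]addr0; apply: cvgD => //.
rewrite -[X in _ --> X](mulr0 n`!%:R^-1).
by apply: cvgMr; exact: cvgr_exprn_expRN.
Qed.

(** The derivatives of consecutive terms telescope: each new term cancels what the previous ones
    left, and only the contribution of the top degree survives. *)
Lemma is_derive_poisson_cdf {R : realType} (n : nat) (c x : R) :
  is_derive x 1 (fun x => poisson_cdf n.+1 (c * x))
    (- c * ((c * x) ^+ n / n`!%:R * expR (- (c * x)))).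
Proof.
elim: n => [|n ih].
  rewrite (_ : (fun x => _) = fun x => expR (- (c * x))); last first.
    by apply/funext => y; rewrite /poisson_cdf big_ord1 expr0 fact0 divr1 mulr1.
  by apply: is_derive_eq; rewrite /GRing.scale/= fact0 expr0 divr1 mul1r mulr1 mulrC.
rewrite (_ : (fun x => _) = fun x =>
  poisson_cdf n.+1 (c * x) + n.+1`!%:R^-1 * ((c * x) ^+ n.+1 * expR (- (c * x)))); last first.
  apply/funext => y.
  by rewrite [LHS]/poisson_cdf big_ord_recr/= mulrDr; congr (_ + _); ring.
have dU : is_derive x 1 (fun y : R => c * y) c.
  by apply: is_derive_eq; rewrite /GRing.scale/= mulr1.
have dE : is_derive x 1 (fun y : R => expR (- (c * y))) (- c * expR (- (c * x))).
  by apply: is_derive_eq; rewrite /GRing.scale/= mulrC.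
have dP : is_derive x 1 (fun y : R => (c * y) ^+ n.+1) (n.+1%:R * (c * x) ^+ n * c).
  rewrite (_ : (fun _ => _) = (fun y : R => c * y) ^+ n.+1).
    exact: is_deriveX.
  by apply/funext => y; rewrite exprfctE.
have dG := is_deriveZ n.+1`!%:R^-1 (is_deriveM dP dE).
apply: (is_derive_eq (is_deriveD ih dG)).
rewrite /GRing.scale/= factS natrM.
have f0 : n`!%:R != 0 :> R by rewrite pnatr_eq0 -lt0n fact_gt0.
have n0 : n.+1%:R != 0 :> R by rewrite pnatr_eq0.
by rewrite exprS; field; rewrite f0 addrC natr1.
Qed.

Lemma gamma_density_ge0 {R : realType} (n : nat) (c t : R) : 0 <= t ->
  0 <= t ^+ n * expR (- (c * t)).
Proof. by move=> t0; rewrite mulr_ge0 ?exprn_ge0 ?expR_ge0. Qed.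

Lemma continuous_gamma_density {R : realType} (n : nat) (c : R) :
  continuous (fun t : R => t ^+ n * expR (- (c * t))).
Proof.
move=> t; apply: cvgM; first exact: exprn_continuous.
apply: continuous_comp; last exact: continuous_expR.
apply: (@continuousN _ R^o); apply: cvgM; [exact: cvg_cst|exact: cvg_id].
Qed.

Lemma integral_gamma_tail {R : realType} (n : nat) (c a : R) : 0 < c -> 0 <= a ->
  (\int[lebesgue_measure]_(t in `[a, +oo[) (t ^+ n * expR (- (c * t)))%:E
   = (n`!%:R / c ^+ n.+1 * poisson_cdf n.+1 (c * a))%:E)%E.
Proof.
move=> c0 a0.
(* An antiderivative of the integrand that tends to 0 at infinity, obtained by rescaling the
   derivative of [poisson_cdf]; the integral is then [- G a]. *)
pose G y : R := - (n`!%:R / c ^+ n.+1) * poisson_cdf n.+1 (c * y).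
have dG (y : R) : is_derive y 1 G (y ^+ n * expR (- (c * y))).
  apply: (is_derive_eq (is_deriveZ (- (n`!%:R / c ^+ n.+1)) (is_derive_poisson_cdf n c y))).
  rewrite /GRing.scale/= exprS exprMn.
  have f0 : n`!%:R != 0 :> R by rewrite pnatr_eq0 -lt0n fact_gt0.
  by field; rewrite f0 expf_neq0 ?gt_eqF.
rewrite (@ge0_continuous_FTC2y _ _ G _ 0) //.
- by rewrite sub0e /G mulNr EFinN oppeK.
- by move=> x ax; apply: gamma_density_ge0; exact: le_trans ax.
- by apply: continuous_subspaceT; exact: continuous_gamma_density.
- rewrite -[X in _ --> X](mulr0 (- (n`!%:R / c ^+ n.+1))).
  by apply: cvgMr; exact: cvgr_poisson_cdf.
- by apply: cvg_at_right_filter; apply: differentiable_continuous; exact/derivable1_diffP.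
- by move=> x _; rewrite derive1E derive_val.
Qed.

Lemma poisson_cdf0 {R : realType} n : poisson_cdf n.+1 (0 : R) = 1.
Proof.
rewrite /poisson_cdf oppr0 expR0 mul1r big_ord_recl/= fact0 expr0 divr1.
by rewrite big1 ?addr0// => i _; rewrite expr0n mul0r.
Qed.

(** * The gamma function and the gamma law for integer shape *)

Lemma upper_gammaE {R : realType} (n : nat) (x : R) : (0 < n)%N -> 0 <= x ->
  upper_gamma n x = n.-1`!%:R * poisson_cdf n x.
Proof.
case: n => // n _ x0; rewrite /upper_gamma /Rintegral/=.
under eq_integral do rewrite -[X in expR (- X)]mul1r.
by rewrite integral_gamma_tail//= expr1n divr1 mul1r.
Qed.

Lemma GammaE {R : realType} (n : nat) : (0 < n)%N -> Gamma n = n.-1`!%:R :> R.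
Proof. by case: n => // n _; rewrite /Gamma upper_gammaE// poisson_cdf0 mulr1. Qed.

Lemma Gamma_gt0 {R : realType} (n : nat) : (0 < n)%N -> 0 < Gamma n :> R.
Proof. by move=> n0; rewrite GammaE// ltr0n fact_gt0. Qed.

Lemma gamma_pdf_ge0 {R : realType} m (theta x : R) : (0 < m)%N -> 0 < theta ->
  0 <= gamma_pdf m theta x.
Proof.
move=> m0 th0; rewrite /gamma_pdf; case: ifPn => // x0.
apply: divr_ge0; first by rewrite mulr_ge0 ?exprn_ge0 ?expR_ge0.
by apply: mulr_ge0; [exact/ltW/Gamma_gt0|exact/exprn_ge0/ltW].
Qed.

Lemma measurable_gamma_pdf {R : realType} m (theta : R) :
  measurable_fun setT (gamma_pdf m theta).
Proof.
rewrite /gamma_pdf; apply: measurable_fun_ifT => //=.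
- by apply: measurable_fun_ler.
- apply: measurable_funM => //; apply: measurable_funM => //.
  by apply: measurableT_comp => //; apply: measurableT_comp => //; apply: measurable_funM.
Qed.

(** In a Poisson process of rate [theta^-1], the arrival number [m] comes after time [a] exactly
    when fewer than [m] arrivals have occurred by then. Analytically, this is [integral_gamma_tail]
    at that rate, normalized. *)
Lemma gamma_law_tail {R : realType} m (theta a : R) : (0 < m)%N -> 0 < theta -> 0 <= a ->
  (\int[lebesgue_measure]_(x in `[a, +oo[) (gamma_pdf m theta x)%:E
   = (poisson_cdf m (a / theta))%:E)%E.
Proof.
case: m => // m _ th0 a0.
have k0 : 0 <= (Gamma m.+1 * theta ^+ m.+1)^-1.
  by rewrite invr_ge0; apply: mulr_ge0; [exact/ltW/Gamma_gt0|exact/exprn_ge0/ltW].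
transitivity (\int[lebesgue_measure]_(x in `[a, +oo[)
    ((Gamma m.+1 * theta ^+ m.+1)^-1%:E * (x ^+ m * expR (- (theta^-1 * x)))%:E))%E.
  apply: eq_integral => x; rewrite inE/= in_itv/= andbT => ax.
  by rewrite /gamma_pdf (le_trans a0 ax) -EFinM [theta^-1 * x]mulrC/= mulrC.
rewrite ge0_integralZl//.
- rewrite integral_gamma_tail ?invr_gt0// -EFinM GammaE//= [theta^-1 * a]mulrC exprVn invrK.
  congr EFin; field.
  by rewrite expf_neq0 ?gt_eqF// pnatr_eq0 -lt0n fact_gt0.
- apply/measurable_EFinP; apply: measurable_funTS; apply: continuous_measurable_fun.
  exact: continuous_gamma_density.
- by move=> x /=; rewrite in_itv/= andbT => ax; rewrite lee_fin gamma_density_ge0// (le_trans a0).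
Qed.

(** * Joint laws, densities and independence *)

(** A product formula on rectangles extends to all measurable sets of the plane by uniqueness of the
    product measure. The side event [C] is carried along so that the extension can be done for one
    pair of variables at a time. *)
Lemma joint_distribution_event {d d1 d2} {T : measurableType d} {T1 : measurableType d1}
    {T2 : measurableType d2} {R : realType} (P : probability T R)
    (X1 : {mfun T >-> T1}) (X2 : {mfun T >-> T2}) (C : set T) :
  measurable C ->
  (forall A B, measurable A -> measurable B ->
    P (X1 @^-1` A `&` X2 @^-1` B `&` C) = (P (X1 @^-1` A) * P (X2 @^-1` B) * P C)%E) ->
  forall S, measurable S ->
  P ((fun w => (X1 w, X2 w)) @^-1` S `&` C) =
    ((distribution P X1 \x distribution P X2) S * P C)%E.
Proof.
move=> mC indepC S mS.
have mX : measurable_fun setT (fun w => (X1 w, X2 w)).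
  by apply: measurable_fun_pair; exact: measurable_funPT.
have c0 : 0 <= fine (P C) by rewrite fine_ge0.
have PC : P C = (fine (P C))%:E by rewrite fineK// fin_num_measure.
(* The constant [P C] is absorbed into the second marginal, so that the right-hand side is itself a
   product measure, to be compared with the law of the pair under [P] restricted to [C]. *)
pose m2 := mscale (NngNum c0) (distribution P X2).
have m2E : (distribution P X1 \x m2)%E S =
    ((distribution P X1 \x distribution P X2) S * P C)%E.
  rewrite /product_measure1/= /m2 /mscale/= muleC PC.
  rewrite ge0_integralZl//; exact: measurable_fun_xsection.
rewrite -m2E.
rewrite (@product_measure_unique _ _ _ _ R (distribution P X1) m2
  (measure_function_pushforward__canonical__measure_function_Measure (mrestr P mC) mX))//.
move=> A B mA mB /=.
rewrite /pushforward /mrestr/= /m2 /mscale/= -PC /distribution /pushforward.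
by rewrite muleCA muleC -indepC//.
Qed.

(** Having a density makes [nu] absolutely continuous; its Radon-Nikodym derivative has the same
    integrals as [p] over all measurable sets, hence equals [p] almost everywhere, and the change of
    variables formula applies. *)
Lemma integral_density {d} {T : measurableType d} {R : realType}
    (mu : {sigma_finite_measure set T -> \bar R}) (nu : {finite_measure set T -> \bar R})
    (p : T -> R) :
  measurable_fun setT p -> (forall x, 0 <= p x) ->
  (forall A, measurable A -> nu A = (\int[mu]_(x in A) (p x)%:E)%E) ->
  forall f : T -> \bar R, measurable_fun setT f -> (forall x, 0 <= f x)%E ->
  (\int[nu]_x f x = \int[mu]_x (f x * (p x)%:E))%E.
Proof.
move=> mp p0 nuE f mf f0.
have mpE : measurable_fun setT (EFin \o p) by exact/measurable_EFinP.
have numu : nu `<< mu.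
  apply/null_content_dominatesP => A mA A0.
  by rewrite nuE// null_set_integral//; exact: measurable_funTS.
rewrite -(Radon_Nikodym_SigmaFinite.change_of_variables numu)//.
apply: ae_eq_integral => //.
- apply: emeasurable_funM => //.
  exact: measurable_int (Radon_Nikodym_SigmaFinite.f_integrable numu).
- exact: emeasurable_funM.
- apply: ae_eqe_mul2l; apply: integral_ae_eq => //.
    exact: Radon_Nikodym_SigmaFinite.f_integrable.
  by move=> E _ mE; rewrite -Radon_Nikodym_SigmaFinite.f_integral// nuE.
Qed.

(* The target is [measurableTypeR R] and not [R], whose display differs from that
   of [lebesgue_measure], against which the laws have a density. *)
Lemma gamma_law_integral {d} {T : measurableType d} {R : realType} (P : probability T R)
    (X : {mfun T >-> measurableTypeR R}) m (theta : R) (f : R -> \bar R) :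
  (0 < m)%N -> 0 < theta -> has_gamma_law P X m theta ->
  measurable_fun setT f -> (forall x, 0 <= f x)%E ->
  (\int[distribution P X]_x f x =
   \int[lebesgue_measure]_(x in `[0%R, +oo[) (f x * (gamma_pdf m theta x)%:E))%E.
Proof.
move=> m0 th0 lawX mf f0.
rewrite (integral_density (@lebesgue_measure R) (distribution P X) (gamma_pdf m theta))//.
- rewrite [RHS]integral_mkcond; apply: eq_integral => x _; rewrite patchE.
  case: ifPn => //; rewrite notin_setE/= in_itv/= andbT => /negP x0.
  by rewrite /gamma_pdf (negbTE x0) mule0.
- exact: measurable_gamma_pdf.
- by move=> x; exact: gamma_pdf_ge0.
Qed.

(** The product measure integrates the masses of sections, and the section at [y] is the half-line
    from [F y], whose mass is a gamma tail. The sign of [F] matters only on the half-line that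
    carries the law of [Y]. *)
Lemma gamma_tail_event {d} {T : measurableType d} {R : realType} (P : probability T R)
    (X Y : {mfun T >-> measurableTypeR R}) m n (theta eta : R) (F : R -> R) :
  (0 < m)%N -> (0 < n)%N -> 0 < theta -> 0 < eta ->
  has_gamma_law P X m theta -> has_gamma_law P Y n eta ->
  measurable_fun setT F -> (forall y, 0 <= y -> 0 <= F y) ->
  ((distribution P Y \x distribution P X) [set z | (F z.1 <= z.2)%R] =
   \int[lebesgue_measure]_(y in `[0%R, +oo[)
     (poisson_cdf m (F y / theta) * gamma_pdf n eta y)%R%:E)%E.
Proof.
move=> m0 n0 th0 eta0 lawX lawY mF F0.
have mS : measurable [set z : measurableTypeR R * measurableTypeR R | F z.1 <= z.2].
  rewrite -[X in measurable X]setTI; apply: measurable_fun_le => //.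
  exact: measurableT_comp.
rewrite /product_measure1.
rewrite (gamma_law_integral P Y n eta _ n0 eta0 lawY)//; last exact: measurable_fun_xsection.
apply: eq_integral => y; rewrite inE/= in_itv/= andbT => y0.
rewrite EFinM; congr (_ * _)%E.
rewrite (_ : xsection _ _ = `[F y, +oo[%classic).
  by rewrite /= /distribution /pushforward lawX// gamma_law_tail// F0.
by apply/seteqP; split => x; rewrite /xsection/= inE/= in_itv/= andbT.
Qed.

Lemma indep4_pairs {d} {T : measurableType d} {R : realType} (P : probability T R)
    (X1 X2 X3 X4 : {mfun T >-> measurableTypeR R}) :
  indep4 P X1 X2 X3 X4 ->
  forall S S', measurable S -> measurable S' ->
  P ((fun w => (X2 w, X1 w)) @^-1` S `&` (fun w => (X4 w, X3 w)) @^-1` S') =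
    ((distribution P X2 \x distribution P X1) S * (distribution P X4 \x distribution P X3) S')%E.
Proof.
move=> indep S S' mS mS'.
have mpre (X : {mfun T >-> measurableTypeR R}) A : measurable A -> measurable (X @^-1` A).
  by move=> mA; rewrite -[X in measurable X]setTI; exact: measurable_funPT.
have indep34 A B : measurable A -> measurable B ->
    P (X3 @^-1` A `&` X4 @^-1` B) = (P (X3 @^-1` A) * P (X4 @^-1` B))%E.
  move=> mA mB; have := indep setT setT A B measurableT measurableT mA mB.
  by rewrite !preimage_setT !setTI probability_setT !mul1e.
have step A B : measurable A -> measurable B ->
    P ((fun w => (X2 w, X1 w)) @^-1` S `&` (X3 @^-1` A `&` X4 @^-1` B)) =
    ((distribution P X2 \x distribution P X1) S * P (X3 @^-1` A `&` X4 @^-1` B))%E.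
  move=> mA mB; apply: joint_distribution_event => //.
    by apply: measurableI; exact: mpre.
  move=> A2 A1 mA2 mA1.
  by rewrite [X2 @^-1` _ `&` _]setIC setIA indep// indep34// !muleA [(P _ * P (X2 @^-1` _))%E]muleC.
have PU : P ((fun w => (X2 w, X1 w)) @^-1` S) = (distribution P X2 \x distribution P X1)%E S.
  have := step setT setT measurableT measurableT.
  by rewrite !preimage_setT !setTI setIT probability_setT mule1.
(* Second use of the extension: the side event is now the one defined by [S], and [step] supplies
   the product formula on rectangles for the other pair. *)
rewrite setIC -PU muleC; apply: joint_distribution_event => //.
  rewrite -[X in measurable X]setTI; apply: measurable_fun_pair => //; exact: measurable_funPT.
move=> A4 A3 mA4 mA3.
by rewrite [X4 @^-1` _ `&` _]setIC setIC step// indep34// PU muleC [(P (X3 @^-1` _) * _)%E]muleC.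
Qed.

(** Gamma gains are nonnegative only almost surely, so the outage event and its threshold
    description agree only off a null set; this transfers the probability. *)
Lemma eq_measure_setD_null {d} {T : measurableType d} {R : realType}
    (mu : {measure set T -> \bar R}) (A B N : set T) :
  measurable A -> measurable B -> measurable N -> mu N = 0%E ->
  A `\` N = B `\` N -> mu A = mu B.
Proof.
move=> mA mB mN N0 AB.
have muD C : measurable C -> mu C = mu (C `\` N).
  move=> mC; rewrite (measureDI mu mC mN) (@subset_measure0 _ _ _ mu (C `&` N) N) ?adde0//.
  exact: measurableI.
by rewrite muD// AB -muD.
Qed.

Lemma measurable_invr {R : realType} : measurable_fun [set: R] (@GRing.inv R).
Proof.
(* The inverse is continuous on the open set of nonzero reals, and at 0 it takes the default value
   0. *)
rewrite -(setvU [set 0]); apply/measurable_funU => //; first exact: measurableC.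
split; last first.
  apply/measurable_restrictT => //=.
  rewrite (_ : _ \_ _ = cst 0)//; apply/funext => y; rewrite patchE.
  by case: ifPn => //; rewrite inE/= => ->; rewrite invr0.
apply: open_continuous_measurable_fun.
  by rewrite openC; exact: closed_eq.
by move=> x; rewrite inE/= => /eqP x0; exact: inv_continuous.
Qed.

(** * Outage of each link as a threshold on one gain *)

Lemma gam_gt0 {R : realType} (r : R) : 0 < r -> 0 < gam r.
Proof.
move=> r0; rewrite /gam subr_gt0 -ltr_ln ?posrE ?powR_gt0// ln1 ln_powR.
by rewrite !mulr_gt0// ln_gt0 ?ltr1n.
Qed.

Lemma half_log2_lt {R : realType} (r A : R) : 0 < A ->
  (2^-1 * log2 A < r) = (A < 1 + gam r).
Proof.
move=> A0; have l2 : 0 < ln 2 :> R by rewrite ln_gt0 ?ltr1n.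
rewrite /gam subrKC -[RHS]ltr_ln ?posrE ?powR_gt0// ln_powR /log2.
by rewrite ltr_pdivrMl// ltr_pdivrMr//.
Qed.

Lemma Psi_factor_ge0 {R : realType} (r x : R) : 0 < r -> `|x| <= 1 -> 1 <= 1 + gam r * (1 - x ^+ 2).
Proof.
move=> r0 x1; rewrite lerDl; apply: mulr_ge0; first exact/ltW/gam_gt0.
by rewrite subr_ge0 -real_normK ?num_real// exprn_ile1.
Qed.

Lemma Psi_ge0 {R : realType} (r x : R) : 0 < r -> `|x| <= 1 -> 0 <= Psi r x.
Proof.
by move=> r0 x1; rewrite /Psi subr_ge0 -[leLHS]sqrtr1 ler_wsqrtr// Psi_factor_ge0.
Qed.

(** Adding [b] to both sides leaves [b] times the square root on the right; both sides are
    nonnegative and may be squared. This is the common target of the two completed squares below. *)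
Lemma lt_mul_Psi {R : realType} (r x b u : R) : 0 < r -> `|x| <= 1 -> 0 < b -> 0 <= u ->
  (u < b * Psi r x) = ((u + b) ^+ 2 < b ^+ 2 * (1 + gam r * (1 - x ^+ 2))).
Proof.
move=> r0 x1 b0 u0; have t1 := Psi_factor_ge0 r x r0 x1.
rewrite /Psi mulrBr mulr1 ltrBrDr.
rewrite -[in RHS](sqr_sqrtr (le_trans ler01 t1)) -exprMn.
by rewrite ltr_pXn2r ?nnegrE ?mulr_ge0 ?sqrtr_ge0 ?addr_ge0// ltW.
Qed.

(** Keeps the argument of [Psi] in the range where its radicand is at least 1. *)
Lemma normr_ratio_le1 {R : realType} (Pr Cx x : R) : 0 < Pr -> 0 <= Cx < 1 -> 0 <= x ->
  `|Pr * x * Cx / (Pr * x + 1)| <= 1.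
Proof.
move=> Pr0 /andP[C0 C1] x0; have p0 : 0 <= Pr * x by rewrite mulr_ge0// ltW.
have b0 : 0 < Pr * x + 1 by lra.
rewrite ger0_norm; last by rewrite divr_ge0 ?mulr_ge0// ltW.
by rewrite ler_pdivrMr// mul1r; nra.
Qed.

Lemma R_sr_ltE {R : realType} (Ps Pr Cx r g x : R) :
  0 < Ps -> 0 < Pr -> 0 <= Cx < 1 -> 0 < r -> 0 <= g -> 0 <= x ->
  (R_sr Ps Pr Cx g x < r) = (g < (Pr * x + 1) / Ps * Psi r (Pr * x * Cx / (Pr * x + 1))).
Proof.
move=> Ps0 Pr0 C01 r0 g0 x0; have /andP[C0 C1] := C01.
have p0 : 0 <= Pr * x by rewrite mulr_ge0// ltW.
have b0 : 0 < Pr * x + 1 by lra.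
have s0 : 0 <= Ps * g by rewrite mulr_ge0// ltW.
rewrite mulrAC ltr_pdivlMr// [g * Ps]mulrC lt_mul_Psi ?(normr_ratio_le1 Pr Cx x)//.
rewrite /R_sr; set p := Pr * x in p0 b0 *; set s := Ps * g in s0 *.
have D0 : 0 < (p + 1) ^+ 2 - (p * Cx) ^+ 2.
  by rewrite subr_sqr mulr_gt0; nra.
have N0 : 0 < (s + p + 1) ^+ 2 - (p * Cx) ^+ 2.
  by rewrite subr_sqr mulr_gt0; nra.
rewrite half_log2_lt ?divr_gt0// ltr_pdivrMr//.
(* Since [(p + 1) ^+ 2] times one minus the squared ratio is the denominator of the rate, the two
   inequalities have the same difference of sides. *)
rewrite -subr_gt0 -[RHS]subr_gt0; congr (0 < _).
by field; rewrite gt_eqF.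
Qed.

Lemma R_rd_ltE {R : realType} (Ps Pr Cx r g s : R) :
  0 < Ps -> 0 < Pr -> 0 <= Cx < 1 -> 0 < r -> 0 <= g -> 0 <= s ->
  (R_rd Ps Pr Cx g s < r) = (g < Psi r Cx / (Pr * (1 - Cx ^+ 2)) * (Ps * s + 1)).
Proof.
move=> Ps0 Pr0 /andP[C0 C1] r0 g0 s0.
have p0 : 0 <= Ps * s by rewrite mulr_ge0// ltW.
have h0 : 0 < Ps * s + 1 by lra.
have u0 : 0 <= Pr * g by rewrite mulr_ge0// ltW.
have q0 : 0 < 1 - Cx ^+ 2 by nra.
have Cn : `|Cx| <= 1 by rewrite ger0_norm// ltW.
rewrite mulrAC ltr_pdivlMr ?mulr_gt0// mulrA [g * Pr]mulrC [Psi _ _ * _]mulrC.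
rewrite lt_mul_Psi//; last by rewrite mulr_ge0// ltW.
rewrite /R_rd -[Pr * g + Ps * s + 1]addrA; set h := Ps * s + 1 in h0 *; set u := Pr * g in u0 *.
have N0 : 0 < (u + h) ^+ 2 - (u * Cx) ^+ 2.
  by rewrite subr_sqr mulr_gt0; nra.
rewrite half_log2_lt ?divr_gt0 ?exprn_gt0// ltr_pdivrMr ?exprn_gt0//.
(* Here [u] also occurs in the subtracted square; multiplying by [1 - Cx ^+ 2] completes the square,
   giving [((1 - Cx ^+ 2) * u + h) ^+ 2]. *)
rewrite -subr_gt0 -[RHS]subr_gt0 -[LHS](pmulr_rgt0 _ q0); congr (0 < _).
ring.
Qed.

(** * Evaluation of the two integrals *)

Lemma measurable_poisson_cdf {R : realType} n : measurable_fun setT (@poisson_cdf R n).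
Proof.
apply: measurable_funM.
  by apply: measurableT_comp => //; exact: measurable_funN.
apply: measurable_sum => k.
by apply: measurable_funM => //; exact: measurable_funX.
Qed.

Lemma measurable_Psi {R : realType} (r : R) : measurable_fun setT (Psi r).
Proof.
rewrite /Psi; apply: measurable_funB => //.
apply: measurableT_comp; first by apply: continuous_measurable_fun; exact: sqrt_continuous.
apply: measurable_funD => //; apply: measurable_funM => //.
by apply: measurable_funB => //; exact: measurable_funX.
Qed.

(** The Poisson factor is [upper_gamma m] divided by [Gamma m], and constants leave the integral.
    Finiteness of [c] is required because [Rintegral] applies [fine], which sends an infinite
    integral to 0. *)
Lemma integral_gamma_tail_upper_gamma {R : realType} (m n : nat) (theta eta : R)
    (F : R -> R) (c : \bar R) :
  (0 < m)%N -> (0 < n)%N -> 0 < theta -> 0 < eta ->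
  measurable_fun setT F -> (forall y, 0 <= y -> 0 <= F y) ->
  (\int[lebesgue_measure]_(y in `[0%R, +oo[)
     (poisson_cdf m (F y / theta) * gamma_pdf n eta y)%R%:E)%E = c -> c \is a fin_num ->
  c = ((Gamma m * Gamma n * eta ^+ n)^-1 *
    Rintegral lebesgue_measure `[0, +oo[%classic
     (fun x : R => x ^+ n.-1 * upper_gamma m (F x / theta) * expR (- (x / eta))))%:E.
Proof.
move=> m0 n0 th0 eta0 mF F0 cE cfin.
set K := Gamma m * Gamma n * eta ^+ n.
have K0 : 0 < K by rewrite !mulr_gt0 ?exprn_gt0 ?Gamma_gt0.
have mf : measurable_fun setT (fun y => (poisson_cdf m (F y / theta) * gamma_pdf n eta y)%:E).
  apply/measurable_EFinP; apply: measurable_funM; last exact: measurable_gamma_pdf.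
  apply: (measurableT_comp (measurable_poisson_cdf m)); exact: measurable_funM.
rewrite /Rintegral.
rewrite (_ : integral _ _ _ = (K%:E * c)%E); last first.
  rewrite -cE -ge0_integralZl ?lee_fin ?(ltW K0)//.
  - apply: eq_integral => y; rewrite inE/= in_itv/= andbT => y0.
    rewrite -EFinM; congr EFin.
    rewrite upper_gammaE//; last by rewrite divr_ge0 ?F0// ltW.
    rewrite /gamma_pdf y0 /K -GammaE//; field.
    by rewrite expf_neq0 ?gt_eqF ?Gamma_gt0.
  - exact: measurable_funTS.
  - move=> y /=; rewrite in_itv/= andbT => y0; rewrite lee_fin mulr_ge0 ?gamma_pdf_ge0//.
    rewrite mulr_ge0 ?expR_ge0// sumr_ge0// => i _.
    by rewrite mulr_ge0 ?invr_ge0 ?ler0n ?exprn_ge0 ?divr_ge0 ?F0// ltW.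
by rewrite fineM// mulrA mulVf ?gt_eqF// mul1r fineK.
Qed.

Lemma integral_gamma_tail_affine {R : realType} (m n : nat) (beta eta a : R) :
  (0 < n)%N -> 0 < eta -> 0 <= beta -> 0 <= a ->
  (\int[lebesgue_measure]_(y in `[0%R, +oo[)
     (poisson_cdf m (beta * (a * y + 1)) * gamma_pdf n eta y)%R%:E)%E =
  (expR (- beta) / (Gamma n * eta ^+ n) *
    \sum_(0 <= i < m) \sum_(0 <= k < i.+1)
      ('C(i, k)%:R * a ^+ k * Gamma (k + n) * beta ^+ i /
       (Gamma i.+1 * (a * beta + eta^-1) ^+ (k + n))))%:E.
Proof.
move=> n0 eta0 b0 a0.
set K := expR (- beta) / (Gamma n * eta ^+ n).
have K0 : 0 <= K.
  by apply: divr_ge0; [exact: expR_ge0|apply: mulr_ge0; [exact/ltW/Gamma_gt0|exact/exprn_ge0/ltW]].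
set c := a * beta + eta^-1.
(* [c] is the total exponential rate: [a * beta] from the Poisson factor and [eta^-1] from the
   density. *)
have c0 : 0 < c by rewrite ltr_wpDl ?mulr_ge0 ?invr_gt0.
pose q (i k : nat) : R := K * ('C(i, k)%:R * a ^+ k * beta ^+ i / i`!%:R).
have q0 i k : 0 <= q i k.
  apply: mulr_ge0 => //; apply: divr_ge0; last exact: ler0n.
  by apply: mulr_ge0; [apply: mulr_ge0; [exact: ler0n|]|]; exact: exprn_ge0.
have mg j : measurable_fun `[0 : R, +oo[ (fun y : R => (y ^+ j * expR (- (c * y)))%:E).
  apply/measurable_EFinP; apply: measurable_funTS; apply: continuous_measurable_fun.
  exact: continuous_gamma_density.
have g0 (j : nat) (y : R) : `[0, +oo[%classic y -> (0 <= (y ^+ j * expR (- (c * y)))%:E)%E.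
  by rewrite /= in_itv/= andbT => y0; rewrite lee_fin gamma_density_ge0.
(* The binomial expansion of [(a * y + 1) ^+ i] turns the integrand into a finite sum of gamma
   densities of rate [c], up to the factors [q i k] free of [y]. *)
transitivity (\int[lebesgue_measure]_(y in `[0%R, +oo[)
   \sum_(0 <= i < m) \sum_(0 <= k < i.+1)
     ((q i k)%:E * (y ^+ (k + n).-1 * expR (- (c * y)))%:E))%E.
  apply: eq_integral => y; rewrite inE/= in_itv/= andbT => y0.
  under eq_bigr do rewrite sumEFin.
  rewrite sumEFin; congr EFin.
  rewrite /poisson_cdf big_mkord /gamma_pdf y0.
  rewrite mulrAC mulr_sumr; apply: eq_bigr => i _.
  rewrite big_mkord exprMn exprD1n [beta ^+ i * _ / _]mulrAC !mulr_sumr; apply: eq_bigr => k _.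
  rewrite -mulr_natr exprMn /q /K /c.
  rewrite -[n in (k + n).-1]prednK// addnS/= exprD.
  rewrite (_ : - (beta * (a * y + 1)) = - beta + - (a * beta * y)); last by ring.
  rewrite (_ : - ((a * beta + eta^-1) * y) = - (a * beta * y) + - (y / eta)); last by ring.
  rewrite !expRD; field.
  by rewrite pnatr_eq0 -lt0n fact_gt0 expf_neq0 ?gt_eqF ?Gamma_gt0.
rewrite ge0_integral_sum//; last 2 first.
- by move=> i; apply: emeasurable_sum => k; exact: (measurable_funeM (q i k)%:E (mg (k + n).-1)).
- move=> i y y0; apply: sume_ge0 => k _; apply: mule_ge0; [by rewrite lee_fin|exact: g0].
rewrite mulr_sumr -sumEFin; apply: eq_bigr => i _.
rewrite ge0_integral_sum//; last 2 first.
- by move=> k; exact: (measurable_funeM (q i k)%:E (mg (k + n).-1)).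
- move=> k y y0; apply: mule_ge0; [by rewrite lee_fin|exact: g0].
rewrite mulr_sumr -sumEFin; apply: eq_bigr => k _.
rewrite ge0_integralZl ?lee_fin//; [|exact: mg|by move=> y; exact: g0].
(* Integration starts at 0, so each term is a complete gamma integral; the Poisson factor becomes 1
   by [poisson_cdf0]. *)
rewrite integral_gamma_tail// mulr0 prednK ?addn_gt0 ?n0 ?orbT//.
have [j kn] : exists j, (k + n)%N = j.+1 by exists (k + n).-1; rewrite prednK// addn_gt0 n0 orbT.
rewrite kn poisson_cdf0 mulr1 -EFinM; congr EFin.
rewrite /q !GammaE//=; field.
by rewrite pnatr_eq0 -lt0n fact_gt0 expf_neq0 ?gt_eqF.
Qed.

(** * Null sets and measurability of the outage event *)

Lemma gamma_law_lt0 {d} {T : measurableType d} {R : realType} (P : probability T R)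
    (X : T -> R) m (theta : R) :
  has_gamma_law P X m theta -> P [set w | X w < 0] = 0%E.
Proof.
move=> lawX; rewrite (_ : [set w | _] = X @^-1` `]-oo, 0[%classic); last first.
  by apply/seteqP; split => w; rewrite /= in_itv.
rewrite lawX//; apply: integral0_eq => x; rewrite /= in_itv/= => x0.
by rewrite /gamma_pdf leNgt x0.
Qed.

Lemma measurable_set_ltr {d} {T : measurableType d} {R : realType} (f g : T -> R) :
  measurable_fun setT f -> measurable_fun setT g -> measurable [set w | f w < g w].
Proof.
move=> mf mg; rewrite (_ : [set w | _] = ~` ([set: T] `&` [set w | g w <= f w])).
  by apply: measurableC; exact: measurable_fun_le.
by apply/seteqP; split => w; rewrite setTI /= ltNge => /negP.
Qed.

Lemma measurable_log2_ratio {d} {T : measurableType d} {R : realType} (f g : T -> R) :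
  measurable_fun setT f -> measurable_fun setT g ->
  measurable_fun setT (fun w => 2^-1 * log2 (f w / g w)).
Proof.
move=> mf mg; apply: measurable_funM => //; apply: measurable_funM => //.
apply: measurableT_comp => //; apply: measurable_funM => //.
exact: measurableT_comp measurable_invr mg.
Qed.

Lemma measurable_R_sr {d} {T : measurableType d} {R : realType} (Ps Pr Cx : R) (f g : T -> R) :
  measurable_fun setT f -> measurable_fun setT g ->
  measurable_fun setT (fun w => R_sr Ps Pr Cx (f w) (g w)).
Proof.
move=> mf mg; have mPg : measurable_fun setT (fun w => Pr * g w) by exact: measurable_funM.
have mPgC : measurable_fun setT (fun w => (Pr * g w * Cx) ^+ 2).
  by apply: measurable_funX; exact: measurable_funM.
apply: measurable_log2_ratio; apply: measurable_funB => //; apply: measurable_funX;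
  apply: measurable_funD => //.
by apply: measurable_funD => //; exact: measurable_funM.
Qed.

Lemma measurable_R_rd {d} {T : measurableType d} {R : realType} (Ps Pr Cx : R) (f g : T -> R) :
  measurable_fun setT f -> measurable_fun setT g ->
  measurable_fun setT (fun w => R_rd Ps Pr Cx (f w) (g w)).
Proof.
move=> mf mg; have mPf : measurable_fun setT (fun w => Pr * f w) by exact: measurable_funM.
have mPg : measurable_fun setT (fun w => Ps * g w) by exact: measurable_funM.
apply: measurable_log2_ratio; last by apply: measurable_funX; exact: measurable_funD.
apply: measurable_funB; apply: measurable_funX; last exact: measurable_funM.
by apply: measurable_funD => //; exact: measurable_funD.
Qed.

(** * The end-to-end outage probability *)

Theorem theorem2 (R : realType) (d : measure_display) (T : measurableType d)
  (P : probability T R) (gsr grr grd gsd : T -> R)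
  (msr mrr mrd msd : nat) (pisr pirr pird pisd Ps : R) :
  (1 <= msr)%N -> (1 <= mrr)%N -> (1 <= mrd)%N -> (1 <= msd)%N ->
  0 < pisr -> 0 < pirr -> 0 < pird -> 0 < pisd -> 0 < Ps ->
  measurable_fun setT gsr -> measurable_fun setT grr ->
  measurable_fun setT grd -> measurable_fun setT gsd ->
  has_gamma_law P gsr msr (pisr / msr%:R) ->
  has_gamma_law P grr mrr (pirr / mrr%:R) ->
  has_gamma_law P grd mrd (pird / mrd%:R) ->
  has_gamma_law P gsd msd (pisd / msd%:R) ->
  indep4 P gsr grr grd gsd ->
  forall (r Pr Cx : R), 0 < r -> 0 < Pr -> 0 <= Cx < 1 ->
  let thsr := pisr / msr%:R in
  let thrr := pirr / mrr%:R in
  let thrd := pird / mrd%:R in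
  let thsd := pisd / msd%:R in
  let beta := Psi r Cx / (Pr * thrd * (1 - Cx ^+ 2)) in
  P [set w | Num.min (R_sr Ps Pr Cx (gsr w) (grr w)) (R_rd Ps Pr Cx (grd w) (gsd w)) < r] =
  (1 - expR (- beta) /
     (Gamma msd * Gamma mrr * Gamma msr * thsd ^+ msd * thrr ^+ mrr) *
     \sum_(0 <= m < mrd) \sum_(0 <= k < m.+1)
        ('C(m, k)%:R * Ps ^+ k * Gamma (k + msd) * beta ^+ m /
          (Gamma m.+1 * (Ps * beta + thsd^-1) ^+ (k + msd)) *
     Rintegral lebesgue_measure `[0, +oo[%classic
       (fun x : R => x ^+ mrr.-1 *
          upper_gamma msr ((Pr * x + 1) / (Ps * thsr) * Psi r (Pr * x * Cx / (Pr * x + 1))) *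
          expR (- (x / thrr)))))%:E.
Proof.
move=> msr0 mrr0 mrd0 msd0 psr0 prr0 prd0 psd0 Ps0 mgsr mgrr mgrd mgsd.
move=> lawsr lawrr lawrd lawsd indep r Pr Cx r0 Pr0 C01 thsr thrr thrd thsd beta.
have /andP[C0 C1] := C01.
have th0 (p : R) n : 0 < p -> (0 < n)%N -> 0 < p / n%:R.
  by move=> p0 n0; rewrite divr_gt0// ltr0n.
have thsr0 : 0 < thsr by exact: th0.
have thrr0 : 0 < thrr by exact: th0.
have thrd0 : 0 < thrd by exact: th0.
have thsd0 : 0 < thsd by exact: th0.
have q0 : 0 < 1 - Cx ^+ 2 by nra.
have Cn : `|Cx| <= 1 by rewrite ger0_norm// ltW.
have beta0 : 0 <= beta.
  by apply: divr_ge0; [exact: Psi_ge0|exact/ltW/mulr_gt0/q0/mulr_gt0].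
(* [F] and [H] are the thresholds of [R_sr_ltE] and [R_rd_ltE], as functions of the interfering
   gains [grr] and [gsd]. *)
pose F x := (Pr * x + 1) / Ps * Psi r (Pr * x * Cx / (Pr * x + 1)).
pose H s := Psi r Cx / (Pr * (1 - Cx ^+ 2)) * (Ps * s + 1).
have mF : measurable_fun setT F.
  have mPx : measurable_fun setT (fun x : R => Pr * x) by exact: measurable_funM.
  have mPx1 : measurable_fun setT (fun x : R => Pr * x + 1) by exact: measurable_funD.
  apply: measurable_funM; first exact: measurable_funM.
  apply: (measurableT_comp (measurable_Psi r)); apply: measurable_funM.
    exact: measurable_funM.
  exact: (measurableT_comp measurable_invr mPx1).
have mH : measurable_fun setT H.
  by apply: measurable_funM => //; apply: measurable_funD => //; exact: measurable_funM.
have F0 y : 0 <= y -> 0 <= F y.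
  move=> y0; have py : 0 <= Pr * y by rewrite mulr_ge0// ltW.
  apply: mulr_ge0; last by apply: Psi_ge0 => //; exact: normr_ratio_le1.
  by rewrite divr_ge0 ?(ltW Ps0)//; lra.
have H0 y : 0 <= y -> 0 <= H y.
  move=> y0; have py : 0 <= Ps * y by rewrite mulr_ge0// ltW.
  apply: mulr_ge0; last by lra.
  by rewrite divr_ge0 ?Psi_ge0// ltW// mulr_gt0.
pose Xsr : {mfun T >-> measurableTypeR R} :=
  @mfun_Sub _ _ T (measurableTypeR R) _ (mem_set mgsr).
pose Xrr : {mfun T >-> measurableTypeR R} :=
  @mfun_Sub _ _ T (measurableTypeR R) _ (mem_set mgrr).
pose Xrd : {mfun T >-> measurableTypeR R} :=
  @mfun_Sub _ _ T (measurableTypeR R) _ (mem_set mgrd).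
pose Xsd : {mfun T >-> measurableTypeR R} :=
  @mfun_Sub _ _ T (measurableTypeR R) _ (mem_set mgsd).
pose S (G : R -> R) : set (measurableTypeR R * measurableTypeR R) := [set z | G z.1 <= z.2].
have mS G : measurable_fun setT G -> measurable (S G).
  move=> mG; rewrite -[X in measurable X]setTI; apply: measurable_fun_le => //.
  exact: measurableT_comp.
(* The event that both links meet the target rate. In each pair the conditioning gain comes first,
   as in [gamma_tail_event]. *)
pose E := (fun w => (Xrr w, Xsr w)) @^-1` S F `&` (fun w => (Xsd w, Xrd w)) @^-1` S H.
have mE : measurable E.
  apply: measurableI; rewrite -[X in measurable X]setTI;
    apply: measurable_fun_pair => //; exact: mS.
have PE : P E = ((distribution P Xrr \x distribution P Xsr) (S F) *
                 (distribution P Xsd \x distribution P Xrd) (S H))%E.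
  by rewrite /E (@indep4_pairs _ _ _ P Xsr Xrr Xrd Xsd)//; exact: mS.
set O := [set w | _].
have mO : measurable O.
  rewrite (_ : O = [set w | R_sr Ps Pr Cx (gsr w) (grr w) < r] `|`
                   [set w | R_rd Ps Pr Cx (grd w) (gsd w) < r]); last first.
    by apply/seteqP; split => w; rewrite /O/= gt_min => /orP.
  apply: measurableU; apply: measurable_set_ltr => //.
    exact: measurable_R_sr.
  exact: measurable_R_rd.
pose N := [set w | gsr w < 0] `|` [set w | grr w < 0] `|` [set w | grd w < 0]
  `|` [set w | gsd w < 0].
have mlt0 (f : T -> R) : measurable_fun setT f -> measurable [set w | f w < 0].
  by move=> mf; exact: measurable_set_ltr.
have nullU (A B : set T) : measurable A /\ P A = 0%E -> measurable B /\ P B = 0%E ->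
    measurable (A `|` B) /\ P (A `|` B) = 0%E.
  by move=> [mA A0] [mB B0]; split; [exact: measurableU|rewrite measureU0].
have [mN N0] : measurable N /\ P N = 0%E.
  apply: (nullU); [apply: (nullU); [apply: (nullU)|]|]; (split; first exact: mlt0).
  - exact: (gamma_law_lt0 _ _ _ _ lawsr).
  - exact: (gamma_law_lt0 _ _ _ _ lawrr).
  - exact: (gamma_law_lt0 _ _ _ _ lawrd).
  - exact: (gamma_law_lt0 _ _ _ _ lawsd).
(* Off [N] all gains are nonnegative, so both threshold equivalences hold and outage is exactly the
   failure of [E]. *)
have PO : P O = P (~` E).
  apply: (eq_measure_setD_null _ _ _ N) => //; first exact: measurableC.
  have OE w : ~ N w -> O w <-> ~ E w.
    move=> nN; have pos (f : T -> R) : ([set w | f w < 0] `<=` N) -> 0 <= f w.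
      by move=> fN; rewrite leNgt; apply/negP => /fN.
    have sr0 : 0 <= gsr w by apply: pos => ? ?; do 3 left.
    have rr0 : 0 <= grr w by apply: pos => ? ?; left; left; right.
    have rd0 : 0 <= grd w by apply: pos => ? ?; left; right.
    have sd0 : 0 <= gsd w by apply: pos => ? ?; right.
    rewrite /O/E/S/= gt_min R_sr_ltE// R_rd_ltE// -/(F (grr w)) -/(H (gsd w)).
    rewrite !ltNge -negb_and; split; first by move=> /negP h /andP.
    by move=> h; apply/negP => /andP.
  by apply/seteqP; split => w [h nN]; split => //; exact/(OE w nN).
have h1 : (distribution P Xrr \x distribution P Xsr)%E (S F) = _ :=
  gamma_tail_event P Xsr Xrr msr mrr thsr thrr F msr0 mrr0 thsr0 thrr0 lawsr lawrr mF F0.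
have h2 : (distribution P Xsd \x distribution P Xrd)%E (S H) = _ :=
  gamma_tail_event P Xrd Xsd mrd msd thrd thsd H mrd0 msd0 thrd0 thsd0 lawrd lawsd mH H0.
have fin1 : (distribution P Xrr \x distribution P Xsr)%E (S F) \is a fin_num.
  apply: (fin_num_measure (product_subprobability
    ((distribution P Xrr : subprobability _ _), (distribution P Xsr : subprobability _ _)))).
  exact: mS.
have e1 := integral_gamma_tail_upper_gamma _ _ _ _ _ _ msr0 mrr0 thsr0 thrr0 mF F0 (esym h1) fin1.
have FE x : F x / thsr = (Pr * x + 1) / (Ps * thsr) * Psi r (Pr * x * Cx / (Pr * x + 1)).
  by rewrite /F; field; rewrite !gt_eqF.
move: e1; under eq_Rintegral do rewrite FE; move=> e1.
have e2 := integral_gamma_tail_affine mrd msd beta thsd Ps msd0 thsd0 beta0 (ltW Ps0).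
rewrite PO probability_setC// PE e1 h2.
under eq_integral => y _.
  (* Dividing the affine threshold by the scale [thrd] produces [beta], which brings the integrand
     to the form treated by [e2]. *)
  rewrite (_ : H y / thrd = beta * (Ps * y + 1)); last first.
    by rewrite /H /beta; field; rewrite !gt_eqF.
  over.
rewrite e2 -!EFinM -EFinB; congr EFin; congr (1 - _).
set I := Rintegral _ _ _.
(* The integral sits inside both sums but depends on neither index, so it factors out. *)
under [in RHS]eq_bigr do rewrite -mulr_suml.
rewrite -mulr_suml.
set B := \sum_(0 <= i < _) _.
field.
rewrite !gt_eqF ?exprn_gt0 ?Gamma_gt0//.
Qed.
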